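(* For integers $m,n\ge 1$, let $\mathrm{Bishop}_{m,n}$ be the $m\times n$ bishop graph and let $\mathcal{R}$ denote the representation number. Then $\mathcal{R}(\mathrm{Bishop}_{m,n})$ is finite for all $m,n\ge 1$, and: \begin{itemize} \item $\mathcal{R}(\mathrm{Bishop}_{1,1})=1$ and $\mathcal{R}(\mathrm{Bishop}_{1,n})=2$ for all $n\ge 2$; \item $\mathcal{R}(\mathrm{Bishop}_{2,n})=2$ and $\mathcal{R}(\mathrm{Bishop}_{3,n})=2$ for all $n\ge 1$; \item $\mathcal{R}(\mathrm{Bishop}_{4,n})=2$ for $n\in\{1,2,3\}$; \item $\mathcal{R}(\mathrm{Bishop}_{4,n})\ge 3$ for all $n\ge 4$. \end{itemize}
   Context: All graphs are finite, simple and undirected. Two distinct letters $x,y$ alternate in a word $w$ if deleting from $w$ all letters other than $x$ and $y$ leaves a word of the form $xyxy\cdots$ or $yxyx\cdots$ (of even or odd length). A word $w$ over the alphabet $V$, in which every letter of $V$ occurs, represents a graph $G=(V,E)$ if for all distinct $x,y\in V$: $x$ and $y$ alternate in $w$ if and only if $(x,y)\in E$. $G$ is word-representable if some word represents it. $G$ is $k$-representable if it is represented by a word in which each letter appears exactly $k$ times. The representation number $\mathcal{R}(G)$ is the smallest integer $k\ge 1$ such that $G$ is $k$-representable; $\mathcal{R}(G)=\infty$ if $G$ is not word-representable. (Every word-representable graph is $k$-representable for some $k$.) The bishop graph $\mathrm{Bishop}_{m,n}$ has vertex set $\{x_{i,j}: 1\le i\le m,\ 1\le j\le n\}$, and two distinct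 vertices $x_{a,b}$, $x_{c,d}$ are adjacent if and only if the squares lie on the same diagonal, i.e. $|a-c|=|b-d|$. *)

(* Defs.v *)
From mathcomp Require Import all_boot ssrint boolp zify.
Set Implicit Arguments.
Unset Strict Implicit.
Unset Printing Implicit Defensive.

Record sgraph := SGraph {
  vertex :> finType;
  edge : rel vertex;
  edge_sym : symmetric edge;
  edge_irrefl : irreflexive edge }.

(* The word x y x y ... of length n. *)
Fixpoint alt_word (T : eqType) (x y : T) (n : nat) : seq T :=
  if n is n'.+1 then x :: alt_word y x n' else [::].

Definition alternate (T : eqType) (x y : T) (w : seq T) : Prop :=
  exists n, let s := [seq z <- w | (z == x) || (z == y)] in
            s = alt_word x y n \/ s = alt_word y x n.

Definition represents (G : sgraph) (w : seq G) : Prop :=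
  (forall x, x \in w) /\
  (forall x y, x != y -> (alternate x y w <-> edge x y)).

Definition word_representable (G : sgraph) : Prop :=
  exists w, @represents G w.

Definition k_representable (G : sgraph) (k : nat) : Prop :=
  exists w, @represents G w /\ (forall x, count_mem x w = k).

Lemma alt_word_sorted (T : eqType) (x y : T) n : x != y ->
  sorted [rel a b | a != b] (alt_word x y n).
Proof.
elim: n x y => [//|[//|n] IHn] x y xy /=; rewrite xy /=.
by have /= := IHn y x; rewrite eq_sym => /(_ xy).
Qed.

Lemma sorted_alt_word (T : eqType) (x y c : T) s :
  all [pred z | (z == x) || (z == y)] (c :: s) ->
  path [rel a b | a != b] c s ->
  c :: s = alt_word x y (size s).+1 \/ c :: s = alt_word y x (size s).+1.
Proof.
elim: s c => [|d s IHs] c /=.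
  by rewrite andbT => /orP[] /eqP->; [left|right].
case/andP=> cxy dsxy /andP[cd /(IHs d dsxy)] /= [] [dE sE]; rewrite dE {1 3}sE.
  by case/orP: cxy cd => /eqP->; rewrite dE ?eqxx // => _; right.
by case/orP: cxy cd => /eqP->; rewrite dE ?eqxx // => _; left.
Qed.

Lemma alternate_sorted (T : eqType) (x y : T) w : x != y ->
  alternate x y w <->
  sorted [rel a b | a != b] [seq z <- w | (z == x) || (z == y)].
Proof.
move=> xy; split=> [[n /= [] ->]|].
- exact: alt_word_sorted.
- by apply: alt_word_sorted; rewrite eq_sym.
have := filter_all [pred z | (z == x) || (z == y)] w.
rewrite /alternate /=; case: [seq z <- w | _] => [|c s] sxy.
  by exists 0; left.
by move=> cs; exists (size s).+1; apply: sorted_alt_word.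
Qed.

Lemma alternating_counts (T : eqType) (a b c : T) s : a != b ->
  all [pred z | (z == a) || (z == b)] (c :: s) ->
  path [rel u v | u != v] c s ->
  count_mem a (c :: s) + (c == b) = count_mem b (c :: s) + (last c s == a).
Proof.
move=> ab; have /negPf ba : b != a by rewrite eq_sym.
elim: s c => [|d s IHs] c.
  by rewrite /= andbT => /orP[] /eqP->; rewrite ?eqxx ?(negPf ab) ?ba.
move=> /andP[/= cab dsab] /andP[/= cd /(IHs d dsab)] /=.
have := dsab => /= /andP[dab _].
by case/orP: cab dab cd => /eqP-> /orP[] /eqP->; rewrite ?eqxx ?(negPf ab) ?ba //;
  lia.
Qed.

Lemma last_undup (T : eqType) (s : seq T) c : last c (undup s) = last c s.
Proof.
elim: s c => //= d s IHs c; case: ifP => [ds|_] /=; last exact: IHs.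
by rewrite IHs; case: s ds {IHs}.
Qed.

Lemma alternate_append (T : eqType) (x y : T) w k : x != y ->
  x \in w -> y \in w -> (forall z, count_mem z w <= k) ->
  alternate x y (w ++ [seq z <- undup w | count_mem z w < k]) <->
  alternate x y w.
Proof.
move=> xy xw yw wk; rewrite !alternate_sorted // filter_cat.
set p := fun z : T => (z == x) || (z == y).
set q := fun z : T => count_mem z w < k.
have -> : [seq z <- [seq z <- undup w | q z] | p z] = filter q (undup (filter p w)).
  by rewrite -filter_undup -!filter_predI; apply: eq_filter => z /=; rewrite andbC.
set s := filter p w.
have cnt z : p z -> count_mem z s = count_mem z w.
  move=> pz; rewrite count_filter; apply: eq_count => u /=.
  by case: eqP => [->|].
have sp : all p s by apply: filter_all.
split=> [|srt]; first by case/cat_sorted2.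
have [xs ys] : x \in s /\ y \in s by rewrite !mem_filter /p !eqxx orbT xw yw.
have [a [b [ab pE uE]]] : exists a b, [/\ a != b, p =1 [pred z | (z == a) || (z == b)]
    & undup s = [:: a; b]].
  have us := undup_uniq s.
  have mu z : (z \in undup s) = p z.
    rewrite mem_undup mem_filter; case: (boolP (p z)) => //=.
    by case/orP=> /eqP->.
  have : perm_eq (undup s) [:: x; y].
    apply: uniq_perm => //=; first by rewrite inE xy.
    by move=> z; rewrite mu !inE.
  move=> pe; have := perm_size pe; move: us mu.
  case: (undup s) => [|a [|b [|? ?]]] //= /andP[]; rewrite inE => ab _ mu _.
  by exists a, b; split=> // z; rewrite -mu !inE.
have lE c : last c s = b by rewrite -last_undup uE.
have [pa pb] : p a /\ p b by rewrite !pE /= !eqxx orbT.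
rewrite uE /=; case: s => [|c s] // in cnt sp srt xs ys uE lE *.
have ccs : count_mem a (c :: s) <= count_mem b (c :: s).
  have := @alternating_counts _ a b c s ab; rewrite -(eq_all pE).
  move=> /(_ sp srt); rewrite -[last c s]/(last c (c :: s)) lE.
  by rewrite [b == a]eq_sym (negPf ab) addn0 => <-; rewrite leq_addr.
rewrite !cnt // in ccs; have := lE c; rewrite /= cat_path => ->.
have -> /= : path [rel a0 b0 | a0 != b0] c s by [].
have ba : b != a by rewrite eq_sym.
case qa : (q a); case qb : (q b); rewrite /= ?ba ?ab //.
by move: (leq_ltn_trans ccs qb); rewrite -[_ < k]/(q a) qa.
Qed.

Lemma represents_append (G : sgraph) (w : seq G) k :
  represents w -> (forall z, count_mem z w <= k) ->
  represents (w ++ [seq z <- undup w | count_mem z w < k]).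
Proof.
move=> [cw ew] wk; split=> [x|x y xy]; first by rewrite mem_cat cw.
by rewrite -ew // alternate_append.
Qed.

(* Repeatedly append to w the word formed by the letters occurring fewer than k
   times, in the order of their last occurrences, until all occur k times. *)
Lemma represents_uniform (G : sgraph) k d (w : seq G) : represents w ->
  (forall z, count_mem z w <= k <= count_mem z w + d) -> k_representable G k.
Proof.
elim: d w => [|d IHd] w rw wk.
  by exists w; split=> // z; have := wk z; lia.
have wk1 z : count_mem z w <= k by case/andP: (wk z).
apply: IHd (represents_append rw wk1) _ => z.
rewrite count_cat (count_uniq_mem _ (filter_uniq _ (undup_uniq w))).
rewrite mem_filter mem_undup rw.1 andbT; have := wk z; lia.
Qed.

Lemma word_representable_uniform (G : sgraph) :
  word_representable G -> exists k, (0 < k) && `[< k_representable G k >].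
Proof.
case=> w rw; exists (size w).+1; apply/asboolP.
apply: (@represents_uniform _ _ (size w).+1 w) => // z.
by rewrite (leq_trans (count_size _ _)) ?leq_addl.
Qed.

(* The representation number; None stands for infinity. *)
Definition repr_number (G : sgraph) : option nat :=
  if pselect (word_representable G) is left wG
  then Some (ex_minn (word_representable_uniform wG))
  else None.

(* Rows and columns are numbered from 0; only their differences matter. *)
Definition bishop_rel (m n : nat) : rel ('I_m * 'I_n) :=
  [rel u v : 'I_m * 'I_n | (u != v) && (`|u.1 - v.1|%N == `|u.2 - v.2|%N)].

Lemma bishop_sym m n : symmetric (@bishop_rel m n).
Proof. by move=> u v; rewrite /bishop_rel /= eq_sym distnC (distnC u.2). Qed.

Lemma bishop_irrefl m n : irreflexive (@bishop_rel m n).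
Proof. by move=> u; rewrite /bishop_rel /= eqxx. Qed.

Definition Bishop (m n : nat) : sgraph :=
  SGraph (@bishop_sym m n) (@bishop_irrefl m n).

(* Main.v *)
(* Word-representability: with f = i + j and g = i - j (shifted to stay in nat),
   two distinct squares are adjacent iff f or g agrees. List the squares
   lexicographically by (f, g), then by (g, f); this breaks the pairs ordered
   oppositely by f and g. For a pair with f and g both strictly increasing from
   x to y, let lo be the squares below y in both keys, hi those above or equal
   to it in both, and mid the others: the word  lo mid lo hi mid hi  separates
   x from y, while all adjacent pairs still alternate in the same phase.

   Three rows: the component of each colour is a circle graph. Put the squares
   of the middle row as nested chords around a centre; the other squares of the
   component form two paths, drawn as overlapping intervals on either side.

   Four rows: the 4 x 4 board contains a triangular prism, which is not a circle
   graph; this is checked by inserting its letters one at a time. *)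
Require Import Defs.
From mathcomp Require Import all_boot ssrint boolp zify.
Set Implicit Arguments.
Unset Strict Implicit.
Unset Printing Implicit Defensive.

(** * Restricting words to two letters *)

Lemma filter_pair (T : eqType) (s : seq T) (x y : T) : x != y ->
  uniq s -> x \in s -> y \in s ->
  let t := [seq z <- s | (z == x) || (z == y)] in t = [:: x; y] \/ t = [:: y; x].
Proof.
move=> xy us xs ys t.
have pt : perm_eq t [:: x; y].
  apply: uniq_perm; rewrite ?filter_uniq //= ?inE ?xy //.
  by move=> z; rewrite mem_filter !inE; case: eqP => [->|_]; case: eqP => [->|].
move: (perm_size pt) (perm_mem pt x) (perm_mem pt y) (perm_uniq pt).
case: t {pt} => [|a [|b [|? ?]]] //= _; rewrite !inE !eqxx ?orbT /= xy.
move=> /orP[]/eqP xE /orP[]/eqP yE _; move: xy; rewrite {}xE {}yE ?eqxx // => _.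
  by left.
by right.
Qed.

Lemma alternateC (T : eqType) (x y : T) w : alternate x y w <-> alternate y x w.
Proof.
rewrite /alternate (eq_filter (a2 := fun z => (z == y) || (z == x))); last first.
  by move=> z; rewrite orbC.
by split=> -[n [] E]; exists n; [right|left|right|left].
Qed.

(** Unlike mere alternation, whole repetitions of [xy] survive concatenation. *)
Definition in_phase (T : eqType) (x y : T) (w : seq T) :=
  exists n, [seq z <- w | (z == x) || (z == y)] = flatten (nseq n [:: x; y]).

Lemma in_phase_alternate (T : eqType) (x y : T) w : in_phase x y w -> alternate x y w.
Proof.
by case=> n E; exists n.*2; left; rewrite E; elim: n {E} => //= n ->.
Qed.

Lemma in_phase_cat (T : eqType) (x y : T) w1 w2 :
  in_phase x y w1 -> in_phase x y w2 -> in_phase x y (w1 ++ w2).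
Proof.
move=> [n E1] [m E2]; exists (n + m).
by rewrite filter_cat E1 E2 nseqD flatten_cat.
Qed.

Lemma in_phase_flatten (T : eqType) (x y : T) ws :
  (forall w, w \in ws -> in_phase x y w) -> in_phase x y (flatten ws).
Proof.
elim: ws => [_|w ws IH H]; first by exists 0.
apply: in_phase_cat; first by apply: H; rewrite mem_head.
by apply: IH => v vw; apply: H; rewrite inE vw orbT.
Qed.

(** * Word-representability from two keys *)

Definition lex_le (T : Type) (f g : T -> nat) : rel T :=
  [rel x y | (f x < f y) || ((f x == f y) && (g x <= g y))].

Lemma lex_le_total (T : Type) (f g : T -> nat) : total (lex_le f g).
Proof. by move=> x y; rewrite /lex_le /=; lia. Qed.

Lemma lex_le_trans (T : Type) (f g : T -> nat) : transitive (lex_le f g).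
Proof. by move=> x y z; rewrite /lex_le /=; lia. Qed.

Section TwoKeys.
Variables (T : finType) (f g : T -> nat).

Definition lex_enum := sort (lex_le f g) (enum T).

(** Elements that share a key are never one in [lo] and one in [hi], and any other two of the three
    blocks alternate in this word. An [x] in [lo] and a [y] in [hi] give [x x y y]. *)
Definition split_word (y : T) : seq T :=
  let lo := [pred z | (f z < f y) && (g z < g y)] in
  let hi := [pred z | (f y <= f z) && (g y <= g z)] in
  let lows := filter lo lex_enum in
  let highs := filter hi lex_enum in
  let mids := filter (predC (predU lo hi)) lex_enum in
  lows ++ mids ++ lows ++ highs ++ mids ++ highs.

Definition two_key_word : seq T :=
  (lex_enum ++ sort (lex_le g f) lex_enum) ++ flatten [seq split_word y | y <- enum T].

Lemma two_key_word_alternate x y : x != y ->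
  alternate x y two_key_word <-> (f x == f y) || (g x == g y).
Proof.
move=> xy.
wlog E : x y xy / [seq z <- lex_enum | (z == x) || (z == y)] = [:: x; y].
  move=> IH; have := @filter_pair _ lex_enum x y xy.
  rewrite sort_uniq enum_uniq !mem_sort !mem_enum => /(_ isT isT isT) [] E.
    exact: IH.
  rewrite alternateC [f x == _]eq_sym [g x == _]eq_sym; apply: IH.
    by rewrite eq_sym.
  by rewrite -E; apply: eq_filter => z; rewrite orbC.
have lexy : lex_le f g x y.
  have := sorted_filter (@lex_le_trans T f g) (fun z => (z == x) || (z == y))
            (sort_sorted (lex_le_total f g) (enum T)).
  by rewrite -/lex_enum E /= andbT.
have E' : [seq z <- sort (lex_le g f) lex_enum | (z == x) || (z == y)] =
    if lex_le g f x y then [:: x; y] else [:: y; x].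
  rewrite filter_sort; [|exact: lex_le_total|exact: lex_le_trans].
  by rewrite E; cbn; case: (_ || _).
have EP P : [seq z <- filter P lex_enum | (z == x) || (z == y)] = filter P [:: x; y].
  by rewrite -E -!filter_predI; apply: eq_filter => z /=; rewrite andbC.
have ES u : [seq z <- split_word u | (z == x) || (z == y)] =
    let lo := [pred z | (f z < f u) && (g z < g u)] in
    let hi := [pred z | (f u <= f z) && (g u <= g z)] in
    let lows := filter lo [:: x; y] in
    let highs := filter hi [:: x; y] in
    let mids := filter (predC (predU lo hi)) [:: x; y] in
    lows ++ mids ++ lows ++ highs ++ mids ++ highs.
  by rewrite !filter_cat !EP.
have yx : y != x by rewrite eq_sym.
split=> [|fg]; last first.
  apply: in_phase_alternate; apply: in_phase_cat.
    exists 2; rewrite filter_cat E E' ifT //=.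
    by move: fg lexy; rewrite /lex_le /=; lia.
  apply: in_phase_flatten => _ /mapP[u _ ->]; exists 2; rewrite ES /=.
  move: fg lexy; rewrite /lex_le /=.
  case: (ltnP (f x) (f u)); case: (ltnP (g x) (g u));
    case: (ltnP (f y) (f u)); case: (ltnP (g y) (g u)) => //=; lia.
(* Both keys differ. If they order the pair oppositely, the two sorted lists give [x y y x];
   otherwise [x] is in [lo] and [y] in [hi] for the factor [split_word y]. *)
rewrite alternate_sorted // /two_key_word filter_cat => S; apply/negPn/negP => fg.
case/cat_sorted2: S; rewrite filter_cat E E'; case: ifP => [l' _|_] /=; last first.
  by rewrite eqxx !andbF.
have ye : y \in enum T by rewrite mem_enum.
case/splitPr: ye => s1 s2; rewrite map_cat flatten_cat filter_cat => /cat_sorted2[_].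
rewrite [map _ _]/= [flatten _]/= filter_cat => /cat_sorted2[+ _]; rewrite ES /=.
have fxy : f x < f y by move: l' lexy fg; rewrite /lex_le /=; lia.
have gxy : g x < g y by move: l' lexy fg; rewrite /lex_le /=; lia.
by rewrite fxy gxy !leqnn !ltnn /= leqNgt fxy /= eqxx.
Qed.

End TwoKeys.

Lemma two_key_representable (G : sgraph) (f g : G -> nat) :
  (forall x y, x != y -> edge x y = (f x == f y) || (g x == g y)) ->
  word_representable G.
Proof.
move=> H; exists (two_key_word f g); split=> [x|x y xy].
  by rewrite /two_key_word !mem_cat mem_sort mem_enum.
by rewrite two_key_word_alternate // H.
Qed.

Lemma bishop_edge m n (u v : Bishop m n) : u != v ->
  edge u v = (`|u.1 - v.1|%N == `|u.2 - v.2|%N).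
Proof.
move=> uv; have -> : edge u v = (u != v) && (`|u.1 - v.1|%N == `|u.2 - v.2|%N) by [].
by rewrite uv.
Qed.

Lemma bishop_word_representable m n : word_representable (Bishop m n).
Proof.
apply: (@two_key_representable (Bishop m n) (fun u : 'I_m * 'I_n => u.1 + u.2)
  (fun u : 'I_m * 'I_n => u.1 + n - u.2)) => -[i j] [k l] ne.
rewrite bishop_edge //=; have := ltn_ord j; have := ltn_ord l; lia.
Qed.

(** * Representation numbers one and two *)

(** Two letters that occur once each always alternate. *)
Lemma one_representable_complete (G : sgraph) (x y : G) :
  k_representable G 1 -> x != y -> edge x y.
Proof.
move=> [w [[cw ew] c1]] xy; apply/ew => //; rewrite alternate_sorted //.
have uw : uniq w by apply/count_mem_uniq => z; rewrite c1 cw.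
have yx : y != x by rewrite eq_sym.
by case: (filter_pair xy uw (cw x) (cw y)) => ->; rewrite /= ?xy ?yx.
Qed.

Lemma repr_number_exists (G : sgraph) : word_representable G ->
  exists r, [/\ repr_number G = Some r, 0 < r, k_representable G r
    & forall k, 0 < k -> k_representable G k -> r <= k].
Proof.
move=> wG; rewrite /repr_number; case: pselect => // w.
case: ex_minnP => r /andP[r0 /asboolP Gr] min; exists r; split=> // k k0 Gk.
by apply: min; rewrite k0; apply/asboolP.
Qed.

Lemma repr_number_eq2 (G : sgraph) (x y : G) : x != y -> ~~ edge x y ->
  k_representable G 2 -> repr_number G = Some 2.
Proof.
move=> xy nxy G2; have [|r [-> r0 Gr /(_ 2 isT G2)]] := @repr_number_exists G.
  by case: G2 => w [rw _]; exists w.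
case: r r0 Gr => [|[|[|]]] // _ /one_representable_complete /(_ xy).
by rewrite (negPf nxy).
Qed.

(* x is the chord with endpoints p x < q x; edges are the crossing pairs. *)
Definition crossing_model (G : sgraph) (p q : G -> nat) :=
  forall x y, [/\ p x < q x, p x != q y
    & x != y -> [/\ p x != p y, q x != q y
      & edge x y = [&& p x < p y, p y < q x & q x < q y] ||
                   [&& p y < p x, p x < q y & q y < q x]]].

(** Reading the endpoints from left to right gives the word: two letters occurring twice each
    alternate exactly when their chords interleave. *)
Lemma crossing_model_2_representable (G : sgraph) (p q : G -> nat) :
  crossing_model p q -> k_representable G 2.
Proof.
move=> H.
pose le1 : rel (nat * G) := fun a b => a.1 <= b.1.
have tot : total le1 by move=> a b; apply: leq_total.
have tr : transitive le1 by move=> a b c; apply: leq_trans.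
pose E := [seq (p x, x) | x <- enum G] ++ [seq (q x, x) | x <- enum G].
pose w := [seq c.2 | c <- sort le1 E].
have cw x : count_mem x w = 2.
  rewrite count_map (permP (permEl (perm_sort _ _))) count_cat.
  have c1 r : count (fun c => c.2 == x) [seq (r z, z) | z <- enum G] = 1.
    rewrite count_map -[LHS]/(count_mem x (enum G)).
    by rewrite (count_uniq_mem _ (enum_uniq _)) mem_enum.
  by rewrite -[LHS]/(count (fun c => c.2 == x) _ + count (fun c => c.2 == x) _) !c1.
exists w; split=> //; split=> [x|x y xy].
  by rewrite -has_pred1 has_count cw.
wlog F : x y xy / [seq z <- enum G | (z == x) || (z == y)] = [:: x; y].
  move=> IH; have := @filter_pair _ (enum G) x y xy.
  rewrite enum_uniq !mem_enum => /(_ isT isT isT) [] F; first exact: IH.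
  rewrite alternateC edge_sym; apply: IH; first by rewrite eq_sym.
  by rewrite -F; apply: eq_filter => z; rewrite orbC.
have yx : y != x by rewrite eq_sym.
have f1 r : [seq c <- [seq (r z, z) | z <- enum G] | (c.2 == x) || (c.2 == y)]
    = [:: (r x, x); (r y, y)].
  rewrite filter_map -[LHS]/(map _ [seq z <- enum G | (z == x) || (z == y)]).
  by rewrite F.
rewrite alternate_sorted // /w filter_map (filter_sort tot tr).
rewrite -[filter _ E]/[seq c <- E | (c.2 == x) || (c.2 == y)] filter_cat !f1.
have [pqx pqxy /(_ xy)[pxy qxy ->]] := H x y.
have [pqy pqyx _] := H y x.
have {tot tr E w cw f1 F H} leE a b : le1 a b = (a.1 <= b.1) by [].
(* With the comparison abstract and the crossing formula hidden behind [R], [cbn] sorts the four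
   endpoints symbolically; each comparison it meets is split into cases. *)
move: le1 leE => le leE.
set R := (X in _ <-> is_true X); have : R = R by []; rewrite {2}/R; move: R => R RE; cbn.
repeat match goal with |- context [le ?a ?b] =>
  rewrite (leE a b); case: (leqP a.1 b.1) => /= ?; cbn end;
  rewrite ?xy ?yx ?eqxx /=; lia.
Qed.

(** * Chords for boards with three rows *)

(* The two colours of squares get disjoint stretches of the line, centred at
   4 n + 16 and 3 (4 n + 16), wide enough that no subtraction below truncates. *)
Section ThreeRows.
Variable n : nat.
Implicit Types i j : nat.

Definition chord_centre i j := (4 * n + 16) * (if odd (i + j) then 3 else 1).

(** A diagonal step between the outer rows changes the row and moves two columns, so each path of
    outer squares stays on one side of the centre. *)
Definition chord_right i j := if i == 0 then j %% 4 < 2 else 2 <= j %% 4.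

Definition chord_start i j :=
  if i == 1 then chord_centre i j - (4 * j + 8)
  else if chord_right i j then chord_centre i j + (4 * j + 2)
  else chord_centre i j - (4 * j + 14).

Definition chord_end i j :=
  if i == 1 then chord_centre i j + (4 * j + 8)
  else if chord_right i j then chord_centre i j + (4 * j + 14)
  else chord_centre i j - (4 * j + 2).

(** Within one colour, a middle chord has radius [4 * l + 8] and an outer one spans distances
    [4 * j + 2] to [4 * j + 14] from the centre. They cross iff the columns, of opposite parity,
    differ by 1; outer chords on one side cross iff their columns differ by 2. *)
Lemma three_rows_crossing i j k l : i < 3 -> k < 3 -> j < n -> l < n ->
  [/\ chord_start i j < chord_end i j, chord_start i j != chord_end k l
   & (i != k) || (j != l) ->
     [/\ chord_start i j != chord_start k l, chord_end i j != chord_end k l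
      & (`|i - k|%N == `|j - l|%N) =
     [&& chord_start i j < chord_start k l, chord_start k l < chord_end i j
       & chord_end i j < chord_end k l] ||
     [&& chord_start k l < chord_start i j, chord_start i j < chord_end k l
       & chord_end k l < chord_end i j]]].
Proof.
move=> i3 k3 jn ln.
rewrite /chord_start /chord_end /chord_centre /chord_right.
case: i i3 => [|[|[|]]] // _; case: k k3 => [|[|[|]]] // _ /=;
 rewrite ?add0n ?add1n ?add2n /= ?negbK.
(* Fixing the residues of the columns modulo 4 fixes sides and colours, leaving linear arithmetic in
   the quotients. *)
all: move: jn ln; have := divn_eq j 4; have := divn_eq l 4.
all: have := ltn_pmod j (isT : 0 < 4); have := ltn_pmod l (isT : 0 < 4).
all: move: (j %/ 4) (l %/ 4) (j %% 4) (l %% 4) => a b r s s4 r4 -> ->.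
all: rewrite ?oddD ?oddM ?andbF ?addFb ?oddS /=.
all: case: r r4 => [|[|[|[|r]]]] // _; case: s s4 => [|[|[|[|s]]]] // _; rewrite /=.
all: (split; [lia|lia|move=> ?; split; [lia|lia|lia]]).
Qed.
End ThreeRows.

(** * Exhaustive search for words with every letter twice *)

Fixpoint insertions (T : Type) (k : T) (c : nat) (u : seq T) : seq (seq T) :=
  if u is a :: u' then
    flatten [seq [seq nseq d k ++ a :: v | v <- insertions k (c - d) u']
            | d <- iota 0 c.+1]
  else [:: nseq c k].

Lemma insertions_cons (T : Type) (k : T) (c : nat) (a : T) (u : seq T) :
  insertions k c (a :: u) =
  flatten [seq [seq nseq d k ++ a :: v | v <- insertions k (c - d) u]
          | d <- iota 0 c.+1].
Proof. by []. Qed.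

Lemma mem_insertions (T : eqType) (k : T) (w : seq T) :
  w \in insertions k (count_mem k w) [seq z <- w | z != k].
Proof.
(* Generalized for induction: [d] counts the copies of [k] already met since the last other
   letter. *)
have step (d : nat) (v : seq T) : nseq d k ++ v \in
    insertions k (d + count_mem k v) [seq z <- v | z != k].
  elim: v d => [|a v IHv] d; first by rewrite /= addn0 cats0 mem_head.
  rewrite [count_mem _ _]/= [filter _ _]/=; case: eqP => [->|_].
    by have := IHv d.+1; rewrite -[d.+1]addn1 nseqD -catA addnA.
  rewrite add0n insertions_cons; apply/flatten_mapP; exists d.
    by rewrite mem_iota /= add0n ltnS leq_addr.
  by rewrite addKn; apply: map_f; apply: (IHv 0).
exact: (step 0).
Qed.

Definition alternateb (i j : nat) (w : seq nat) :=
  sorted [rel a b | a != b] [seq z <- w | (z == i) || (z == j)].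

(** Pruning after each letter keeps the search small. Only pairs with the new letter are tested, as
    insertion does not affect the earlier pairs. *)
Fixpoint two_uniform_words (adj : rel nat) (k : nat) : seq (seq nat) :=
  if k is k'.+1 then
    [seq w <- flatten [seq insertions k' 2 u | u <- two_uniform_words adj k']
    | all (fun i => alternateb i k' w == adj i k') (iota 0 k')]
  else [:: [::]].

(** Completeness of the search, so that an empty result refutes representability. *)
Lemma mem_two_uniform_words (adj : rel nat) (k : nat) (w : seq nat) :
  (forall i, i < k -> count_mem i w = 2) ->
  (forall i j, i < j < k -> alternateb i j w = adj i j) ->
  [seq z <- w | z < k] \in two_uniform_words adj k.
Proof.
elim: k => [|k IHk] cw aw; first by rewrite (eq_filter (a2 := pred0)) // filter_pred0.
rewrite /= mem_filter; apply/andP; split.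
  apply/allP => i; rewrite mem_iota /= add0n => ik; rewrite -aw ?ik ?leqnn //.
  rewrite /alternateb -filter_predI.
  by apply/eqP; congr sorted; apply: eq_filter => z /=; lia.
apply/flatten_mapP; exists [seq z <- w | z < k].
  by apply: IHk => [i ik|i j /andP[ij jk]]; [apply: cw|apply: aw]; lia.
have := mem_insertions k [seq z <- w | z < k.+1].
rewrite -filter_predI count_filter.
rewrite (eq_count (a2 := pred1 k)) ?cw //; last by move=> z /=; lia.
by rewrite (eq_filter (a1 := predI _ _) (a2 := fun z => z < k)) // => z /=; lia.
Qed.

Lemma induced_two_uniform_words (G : sgraph) (adj : rel nat) (k : nat) (h : nat -> G) :
  {in [pred i | i < k] &, injective h} ->
  (forall i j, i < j < k -> edge (h i) (h j) = adj i j) ->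
  k_representable G 2 -> two_uniform_words adj k != [::].
Proof.
move=> hI hadj [w [[cw ew] w2]].
(* Vertices outside the copy get the index [k], which the filter [z < k] removes. *)
pose c x := index x (mkseq h k).
have uh : uniq (mkseq h k) by apply/(mkseq_uniqP h) => i j ik jk; apply: hI.
have cE i x : i < k -> (c x == i) = (x == h i).
  move=> ik; rewrite /c -[in RHS](nth_mkseq (h i) h ik).
  apply/eqP/eqP => [iE|->]; last by rewrite index_uniq ?size_mkseq.
  rewrite -iE in ik *.
  case: (boolP (x \in mkseq h k)) => [xh|]; first by rewrite nth_index.
  by rewrite -index_mem size_mkseq ik.
suff : [seq z <- map c w | z < k] \in two_uniform_words adj k by case: two_uniform_words.
apply: mem_two_uniform_words => [i ik|i j /andP[ij jk]].
  by rewrite count_map -(w2 (h i)); apply: eq_count => x /=; rewrite cE.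
have ik : i < k by lia.
have hij : h i != h j by apply/eqP => /hI; rewrite !inE => /(_ ik jk); lia.
rewrite -hadj ?ij // /alternateb filter_map sorted_map.
rewrite (eq_filter (a2 := fun x => (x == h i) || (x == h j))); last first.
  by move=> x /=; rewrite !cE.
rewrite (@eq_in_sorted _ [pred x | (x == h i) || (x == h j)] _ [rel a b | a != b]).
- apply/idP/idP => [/(alternate_sorted _ hij)/ew-/(_ hij)|] //.
  by move=> /(ew _ _ hij)/(alternate_sorted _ hij).
- have [ci cj] : c (h i) = i /\ c (h j) = j by split; apply/eqP; rewrite cE.
  have hji : h j != h i by rewrite eq_sym.
  move=> x y; rewrite !inE /= => /orP[]/eqP-> /orP[]/eqP->;
    rewrite ?ci ?cj ?eqxx // ?hij ?hji; lia.
- exact: filter_all.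
Qed.

(** * The prism in boards with four rows *)

(* A copy of the triangular prism: the antidiagonal triangles {02, 11, 20} and {13, 22, 31}. *)
Definition prism_cells : seq (nat * nat) :=
  [:: (1, 1); (2, 2); (0, 2); (2, 0); (1, 3); (3, 1)].

Definition prism_cell (i : nat) : nat * nat := nth (0, 0) prism_cells i.

Definition prism_adj : rel nat := [rel i j |
  let u := prism_cell i in let v := prism_cell j in
  `|u.1 - v.1|%N == `|u.2 - v.2|%N].

Lemma prism_not_circle : two_uniform_words prism_adj 6 = [::].
Proof. by vm_compute. Qed.

Lemma bishop4_not_2_representable n : 4 <= n -> ~ k_representable (Bishop 4 n) 2.
Proof.
case: n => // n n4.
(* [inord] is faithful here: the coordinates are at most 3 and both sides of the board at least
   4. *)
pose h i : Bishop 4 n.+1 := (inord (prism_cell i).1, inord (prism_cell i).2).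
have cell_lt i : i < 6 -> ((prism_cell i).1 < 4) && ((prism_cell i).2 < 4).
  by do 6 (case: i => [|i] //).
have h1 i : i < 6 -> (h i).1 = (prism_cell i).1 :> nat.
  by move/cell_lt => /andP[? ?]; rewrite inordK.
have h2 i : i < 6 -> (h i).2 = (prism_cell i).2 :> nat.
  by move/cell_lt => /andP[_ ?]; rewrite inordK //; lia.
have cellI : {in [pred i | i < 6] &, injective prism_cell}.
  exact: (elimT (uniqP (0, 0)) (isT : uniq prism_cells)).
have hI : {in [pred i | i < 6] &, injective h}.
  move=> i j i6 j6 ij; apply: cellI => //.
  by rewrite [LHS]surjective_pairing [RHS]surjective_pairing -!h1 // -!h2 // ij.
have hadj i j : i < j < 6 -> edge (h i) (h j) = prism_adj i j.
  move=> /andP[ij j6]; have i6 : i < 6 by lia.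
  rewrite bishop_edge ?h1 ?h2 //.
  by apply/eqP => /hI; rewrite !inE => /(_ i6 j6); lia.
by move=> /(induced_two_uniform_words hI hadj); rewrite prism_not_circle.
Qed.

(** * Representation numbers of bishop graphs *)

Lemma neq_pair_nat m n (u v : 'I_m * 'I_n) :
  (u != v) = (u.1 != v.1 :> nat) || (u.2 != v.2 :> nat).
Proof. by rewrite -pair_eqE negb_and. Qed.

Lemma bishop_2_representable m n : (m <= 3) || (n <= 3) ->
  k_representable (Bishop m n) 2.
Proof.
case/orP => le3.
  apply: (@crossing_model_2_representable (Bishop m n)
    (fun u => chord_start n u.1 u.2) (fun u => chord_end n u.1 u.2)) => u v.
  have u3 := leq_trans (ltn_ord u.1) le3; have v3 := leq_trans (ltn_ord v.1) le3.
  have [pq pq' cr] := three_rows_crossing u3 v3 (ltn_ord u.2) (ltn_ord v.2).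
  split=> // uv; have := uv; rewrite neq_pair_nat => /cr[? ? <-]; split=> //.
  by rewrite bishop_edge.
(* At most three columns: the same chords on the transposed board. *)
apply: (@crossing_model_2_representable (Bishop m n)
  (fun u => chord_start m u.2 u.1) (fun u => chord_end m u.2 u.1)) => u v.
have u3 := leq_trans (ltn_ord u.2) le3; have v3 := leq_trans (ltn_ord v.2) le3.
have [pq pq' cr] := three_rows_crossing u3 v3 (ltn_ord u.1) (ltn_ord v.1).
split=> // uv; have := uv; rewrite neq_pair_nat orbC => /cr[? ? <-]; split=> //.
by rewrite bishop_edge // eq_sym.
Qed.

Lemma bishop_incomplete m n : 1 < maxn m n -> 0 < minn m n ->
  exists u v : Bishop m n, u != v /\ ~~ edge u v.
Proof.
rewrite leq_max leq_min => mn /andP[m0 n0].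
have [m1|n1] := orP mn.
  exists (Ordinal m0, Ordinal n0), (Ordinal m1, Ordinal n0).
  by split=> //; rewrite bishop_edge.
exists (Ordinal m0, Ordinal n0), (Ordinal m0, Ordinal n1).
by split=> //; rewrite bishop_edge.
Qed.

Lemma bishop_repr_number_2 m n : 0 < m -> 0 < n -> 1 < maxn m n ->
  minn m n <= 3 -> repr_number (Bishop m n) = Some 2.
Proof.
move=> m0 n0 mn1 mn3; have [||u [v [uv nuv]]] := @bishop_incomplete m n; try lia.
apply: repr_number_eq2 uv nuv _; apply: bishop_2_representable; lia.
Qed.

Lemma bishop11_repr_number : repr_number (Bishop 1 1) = Some 1.
Proof.
have eq1 (u v : Bishop 1 1) : u = v.
  by case: u v => [i j] [k l]; rewrite !(ord1 i) !(ord1 j) !(ord1 k) !(ord1 l).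
have [|r [-> r0 _ /(_ 1 isT) r1]] := @repr_number_exists (Bishop 1 1).
  exact: bishop_word_representable.
suff /r1 : k_representable (Bishop 1 1) 1 by move=> ?; congr Some; lia.
exists [:: (ord0, ord0) : Bishop 1 1]; split; first split.
- by move=> u; rewrite inE (eq1 u (ord0, ord0)).
- by move=> u v; rewrite (eq1 u v) eqxx.
- by move=> u; rewrite (eq1 u (ord0, ord0)).
Qed.

Theorem mainTheorem4 :
  (forall m n : nat, 1 <= m -> 1 <= n ->
     exists r : nat, repr_number (Bishop m n) = Some r) /\
  (repr_number (Bishop 1 1) = Some 1 /\
   (forall n : nat, 2 <= n -> repr_number (Bishop 1 n) = Some 2)) /\
  (forall n : nat, 1 <= n ->
     repr_number (Bishop 2 n) = Some 2 /\ repr_number (Bishop 3 n) = Some 2) /\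
  (forall n : nat, n \in [:: 1; 2; 3] -> repr_number (Bishop 4 n) = Some 2) /\
  (forall n : nat, 4 <= n ->
     exists2 r : nat, repr_number (Bishop 4 n) = Some r & 3 <= r).
Proof.
split=> [m n _ _|].
  by have [r [-> _ _ _]] := repr_number_exists (bishop_word_representable m n); exists r.
split; first by split=> [|n n2]; [exact: bishop11_repr_number|apply: bishop_repr_number_2; lia].
split=> [n n1|]; first by split; apply: bishop_repr_number_2; lia.
split=> [n|n n4]; first by rewrite !inE => nE; apply: bishop_repr_number_2; lia.
have [r [-> r0 rr _]] := repr_number_exists (bishop_word_representable 4 n).
(* The value 1 would make the graph complete; the value 2 is excluded by the prism. *)
exists r => //; case: r r0 rr => [|[|[|]]] // _ rr.
  have [||u [v [uv /negP[]]]] := @bishop_incomplete 4 n; try lia.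
  exact: one_representable_complete.
by case: (bishop4_not_2_representable n4).
Qed.
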